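(* For any commutative ring $R$ and any index set $I$, the ring of Laurent polynomials $R[x_k^{\pm1}: k\in I]$ is canonically isomorphic to the group-ring $R[\bigoplus_{k\in I}\mathbb{Z}]$.
   Context: The ring of Laurent polynomials $R[x_k^{\pm1}:k\in I]$ is the localization of the polynomial ring $R[x_k:k\in I]$ at the multiplicative set of all monomials $\prod_k x_k^{n_k}$ (with $n_k\in\mathbb{N}=\{0,1,2,\ldots\}$, almost all zero). For an abelian group $A$ (written additively), the group-ring $R[A]$ is the free $R$-module with basis $\{\epsilon_a:a\in A\}$ and multiplication determined by $\epsilon_a\epsilon_b=\epsilon_{a+b}$. The canonical map is the $R$-algebra homomorphism sending $x_k$ to $\epsilon_{e_k}$, where $e_k\in\bigoplus_{k\in I}\mathbb{Z}$ is the $k$-th standard basis element. *)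

(* Defs.v *)
From HB Require Import structures.
From mathcomp Require Import all_boot all_order all_algebra finmap boolp ring.
From mathcomp.multinomials Require Import monalg.

Set Implicit Arguments.
Unset Strict Implicit.
Unset Printing Implicit Defensive.

Import GRing.Theory.
Local Open Scope fset_scope.
Local Open Scope ring_scope.
Local Open Scope quotient_scope.

(* Rings here are comPzRingType, so that the zero ring is allowed; the library's
   algebra structures (lalgType, algType, {lrmorphism _ -> _}) and the ring
   structure on {malg R[K]} all require 1 != 0. An R-algebra is therefore a
   comPzRingType that also carries an lmodType R structure, and an R-algebra
   homomorphism is a ring morphism f such that scalable f. *)

Section DirectSum.
Variable I : choiceType.

Definition dirsum (A : nmodType) : Type := {fsfun I -> A with 0}.

HB.instance Definition _ (A : nmodType) := Choice.on (dirsum A).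

Section Nmod.
Variable A : nmodType.
Implicit Types u v w : dirsum A.

Definition dirsum_fun u : I -> A := fun k => (u : {fsfun I -> A with 0}) k.
Definition dsupp u : {fset I} := finsupp (u : {fsfun I -> A with 0}).

Definition dirsum0 : dirsum A := [fsfun].
Definition dirsum_add u v : dirsum A :=
  [fsfun k in dsupp u `|` dsupp v => dirsum_fun u k + dirsum_fun v k].

Lemma dirsumP u v : (forall k, dirsum_fun u k = dirsum_fun v k) -> u = v.
Proof. by move=> uv; apply/fsfunP. Qed.

Lemma dsuppPn u k : k \notin dsupp u -> dirsum_fun u k = 0.
Proof. exact: fsfun_dflt. Qed.

Lemma dirsum0E k : dirsum_fun dirsum0 k = 0.
Proof. by rewrite /dirsum_fun fsfunE. Qed.

Lemma dirsum_addE u v k :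
  dirsum_fun (dirsum_add u v) k = dirsum_fun u k + dirsum_fun v k.
Proof.
rewrite [LHS]fsfunE; case: ifPn => //; rewrite in_fsetU negb_or => /andP[uk vk].
by rewrite !dsuppPn ?addr0.
Qed.

Fact dirsum_addA : associative dirsum_add.
Proof. by move=> u v w; apply: dirsumP => k; rewrite !dirsum_addE addrA. Qed.

Fact dirsum_addC : commutative dirsum_add.
Proof. by move=> u v; apply: dirsumP => k; rewrite !dirsum_addE addrC. Qed.

Fact dirsum_add0 : left_id dirsum0 dirsum_add.
Proof. by move=> u; apply: dirsumP => k; rewrite dirsum_addE dirsum0E add0r. Qed.

HB.instance Definition _ :=
  GRing.isNmodule.Build (dirsum A) dirsum_addA dirsum_addC dirsum_add0.

Definition dirsum_in (k : I) (a : A) : dirsum A := [fsfun j in [fset k] => a].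

Lemma dirsum_inE k a j : dirsum_fun (dirsum_in k a) j = if j == k then a else 0.
Proof. by rewrite [LHS]fsfunE in_fset1. Qed.

End Nmod.

Section Zmod.
Variable A : zmodType.

Definition dirsum_opp (u : dirsum A) : dirsum A :=
  [fsfun k in dsupp u => - dirsum_fun u k].

Lemma dirsum_oppE u k : dirsum_fun (dirsum_opp u) k = - dirsum_fun u k.
Proof. by rewrite [LHS]fsfunE; case: ifPn => // /dsuppPn ->; rewrite oppr0. Qed.

Fact dirsum_addN : left_inverse 0 dirsum_opp +%R.
Proof.
move=> u; apply: dirsumP => k.
by rewrite [LHS]dirsum_addE dirsum_oppE addNr dirsum0E.
Qed.

HB.instance Definition _ := GRing.Nmodule_isZmodule.Build (dirsum A) dirsum_addN.

End Zmod.
End DirectSum.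

(* The algebra R[A] of a commutative monoid A, written additively: the free
   R-module on the basis (eps a) with eps a * eps b = eps (a + b). It is the
   group ring when A is an abelian group, and the polynomial ring
   R[x_k : k in I] when A is the monoid of exponents dirsum I nat. *)
Definition monoid_algebra (R : comPzRingType) (A : nmodType) : Type := {malg R[A]}.

HB.instance Definition _ (R : comPzRingType) (A : nmodType) :=
  GRing.Zmodule.on (monoid_algebra R A).

Definition eps (R : comPzRingType) (A : nmodType) (a : A) : monoid_algebra R A :=
  << (1 : R) *g a >>.

HB.lock Definition monoid_algebra_mul (R : comPzRingType) (A : nmodType)
    (g h : monoid_algebra R A) : monoid_algebra R A :=
  \sum_(a <- msupp g) \sum_(b <- msupp h) << g@_a * h@_b *g (a + b)%R >>.

HB.lock Definition monoid_algebra_scale (R : comPzRingType) (A : nmodType)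
    (c : R) (g : monoid_algebra R A) : monoid_algebra R A :=
  \sum_(a <- msupp g) << c * g@_a *g a >>.

Section MonoidAlgebra.
Variables (R : comPzRingType) (A : nmodType).
Implicit Types g h : monoid_algebra R A.

Local Notation eps := (@eps R A).
Local Notation mul := (@monoid_algebra_mul R A).
Local Notation scale := (@monoid_algebra_scale R A).

Lemma mulw (d1 d2 : {fset A}) g h : msupp g `<=` d1 -> msupp h `<=` d2 ->
  mul g h = \sum_(a <- d1) \sum_(b <- d2) << g@_a * h@_b *g (a + b)%R >>.
Proof.
move=> le1 le2; rewrite unlock (big_fset_incl _ le1) /=.
  apply: eq_bigr => a _; apply: big_fset_incl => // b _ /mcoeff_outdom ->.
  by rewrite mulr0 monalgU0.
move=> a _ /mcoeff_outdom ga; rewrite big1 // => b _.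
by rewrite ga mul0r monalgU0.
Qed.

Fact mul_C : commutative mul.
Proof.
move=> g h; rewrite unlock exchange_big /=; apply: eq_bigr => a _.
by apply: eq_bigr => b _; rewrite mulrC addrC.
Qed.

Fact mul_Dl : left_distributive mul +%R.
Proof.
move=> g1 g2 h.
rewrite (mulw (msuppD_le g1 g2) (fsubset_refl _)).
rewrite (mulw (fsubsetUl _ (msupp g2)) (fsubset_refl _)).
rewrite (mulw (fsubsetUr (msupp g1) _) (fsubset_refl _)).
rewrite -big_split /=; apply: eq_bigr => a _.
rewrite -big_split /=; apply: eq_bigr => b _.
by rewrite mcoeffD mulrDl monalgUD.
Qed.

Fact mul_Dr : right_distributive mul +%R.
Proof. by move=> g h1 h2; rewrite mul_C mul_Dl !(mul_C g). Qed.

Fact mul_0l h : mul 0 h = 0.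
Proof. by rewrite unlock msupp0 big_seq_fset0. Qed.

Fact mul_0r h : mul h 0 = 0.
Proof. by rewrite mul_C mul_0l. Qed.

Lemma mulUU (c d : R) (a b : A) :
  mul << c *g a >> << d *g b >> = << c * d *g (a + b)%R >>.
Proof. by rewrite (mulw msuppU_le msuppU_le) !big_seq_fset1 !mcoeffUU. Qed.

Let mul_suml J (s : seq J) F h :
  mul (\sum_(j <- s) F j) h = \sum_(j <- s) mul (F j) h.
Proof. exact: (big_morph (mul^~ h) (fun x y => mul_Dl x y h) (mul_0l h)). Qed.

Let mul_sumr J (s : seq J) F h :
  mul h (\sum_(j <- s) F j) = \sum_(j <- s) mul h (F j).
Proof. exact: (big_morph (mul h) (fun x y => mul_Dr h x y) (mul_0r h)). Qed.

Lemma mulEl g h : mul g h = \sum_(a <- msupp g) mul << g@_a *g a >> h.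
Proof. by rewrite {1}(monalgE g) mul_suml. Qed.

Lemma mulEr g h : mul g h = \sum_(b <- msupp h) mul g << h@_b *g b >>.
Proof. by rewrite {1}(monalgE h) mul_sumr. Qed.

Fact mul_A : associative mul.
Proof.
move=> g1 g2 g3; rewrite mulEl (mulEl g1 g2) [RHS]mul_suml.
apply: eq_bigr => a _; rewrite (mulEl g2 g3) (mulEr _ g2) mul_sumr [RHS]mul_suml.
apply: eq_bigr => b _; rewrite (mulEr _ g3) [RHS]mulEr mul_sumr.
by apply: eq_bigr => c _; rewrite !mulUU mulrA addrA.
Qed.

Fact mul_1l : left_id (eps 0) mul.
Proof.
move=> g; rewrite mulEr [RHS]monalgE.
by apply: eq_bigr => a _; rewrite mulUU mul1r add0r.
Qed.

Fact mul_1r : right_id (eps 0) mul.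
Proof. by move=> g; rewrite mul_C mul_1l. Qed.

HB.instance Definition _ := GRing.Zmodule_isPzRing.Build (monoid_algebra R A)
  mul_A mul_1l mul_1r mul_Dl mul_Dr.
HB.instance Definition _ :=
  GRing.PzRing_hasCommutativeMul.Build (monoid_algebra R A) mul_C.

Lemma scaleE c g a : (scale c g)@_a = c * g@_a.
Proof.
rewrite {2}(monalgE g) unlock !raddf_sum mulr_sumr /=.
by apply: eq_bigr => b _; rewrite !mcoeffU mulrnAr.
Qed.

Fact scale_A c d g : scale c (scale d g) = scale (c * d) g.
Proof. by apply/malgP => a; rewrite !scaleE mulrA. Qed.

Fact scale_1 : left_id 1 scale.
Proof. by move=> g; apply/malgP => a; rewrite scaleE mul1r. Qed.

Fact scale_Dr : right_distributive scale +%R.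
Proof. by move=> c g h; apply/malgP => a; rewrite mcoeffD !scaleE mcoeffD mulrDr. Qed.

Fact scale_Dl g : {morph scale^~ g : c d / c + d}.
Proof. by move=> c d; apply/malgP => a; rewrite mcoeffD !scaleE mulrDl. Qed.

HB.instance Definition _ := GRing.Zmodule_isLmodule.Build R (monoid_algebra R A)
  scale_A scale_1 scale_Dr scale_Dl.

Lemma eps0 : eps 0 = 1.
Proof. by []. Qed.

Lemma epsD a b : eps (a + b) = eps a * eps b.
Proof. by rewrite [RHS]mulUU mulr1. Qed.

Lemma epsMn a n : eps (a *+ n) = eps a ^+ n.
Proof. by elim: n => [|n IHn]; rewrite ?mulr0n // mulrS epsD IHn exprS. Qed.

Lemma eps_sum J (s : seq J) (F : J -> A) :
  eps (\sum_(j <- s) F j) = \prod_(j <- s) eps (F j).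
Proof. exact: (big_morph eps epsD eps0). Qed.

Lemma monoid_algebraE g : g = \sum_(a <- msupp g) g@_a *: eps a.
Proof.
rewrite {1}(monalgE g); apply: eq_bigr => a _; apply/malgP => b.
by rewrite [RHS]scaleE !mcoeffU mulrnAr mulr1.
Qed.

Lemma scale_mull c g h : c *: (g * h) = (c *: g) * h.
Proof.
rewrite [g](monalgE) [h](monalgE).
have scaleU d (a : A) (e : R) : d *: (<< e *g a >> : monoid_algebra R A) = << d * e *g a >>.
  by apply/malgP => b; rewrite [LHS]scaleE !mcoeffU mulrnAr.
rewrite [X in c *: X]mul_suml scaler_sumr [X in X * _]scaler_sumr [RHS]mul_suml.
apply: eq_bigr => a _; rewrite mul_sumr scaler_sumr [RHS]mul_sumr.
by apply: eq_bigr => b _; rewrite mulUU !scaleU mulUU mulrA.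
Qed.

End MonoidAlgebra.

(* The localization of a commutative ring A at a multiplicative subset S:
   fractions a/s with a/s = b/t iff u (a t) = u (b s) for some u in S. *)
Section Localization.
Variables (A : comPzRingType) (S : mulrClosed A).

Local Notation ratios := (A * {s : A | s \in S})%type.
Implicit Types x y z : ratios.

Definition loc_equiv x y : bool :=
  `[< exists2 u, u \in S & u * (x.1 * val y.2) = u * (y.1 * val x.2) >].

Lemma loc_equiv_refl : reflexive loc_equiv.
Proof. by move=> x; apply/asboolP; exists 1; rewrite ?rpred1. Qed.

Lemma loc_equiv_sym : symmetric loc_equiv.
Proof. by move=> x y; apply/asboolP/asboolP=> -[u Su xy]; exists u. Qed.

Lemma loc_equiv_trans : transitive loc_equiv.
Proof.
move=> [b [t St]] [a [s Ss]] [c [r Sr]] /asboolP[/= u Su xy] /asboolP[/= v Sv yz].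
apply/asboolP; exists (u * v * t); rewrite /= ?rpredM //.
have -> : u * v * t * (a * r) = v * r * (u * (a * t)) by ring.
rewrite xy; have -> : v * r * (u * (b * s)) = u * s * (v * (b * r)) by ring.
by rewrite yz; ring.
Qed.

Canonical loc_equiv_rel :=
  EquivRel loc_equiv loc_equiv_refl loc_equiv_sym loc_equiv_trans.

Definition localization : Type := {eq_quot loc_equiv}.

HB.instance Definition _ : EqQuotient _ loc_equiv localization :=
  EqQuotient.on localization.
HB.instance Definition _ := Choice.on localization.

Lemma loc_eqP x y :
  reflect (exists2 u, u \in S & u * (x.1 * val y.2) = u * (y.1 * val x.2))
          (x == y %[mod localization]).
Proof. by rewrite eqmodE; apply: asboolP. Qed.

Definition denom1 : {s : A | s \in S} := exist _ 1 (rpred1 _).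
Definition denomM (s t : {s : A | s \in S}) : {s : A | s \in S} :=
  exist _ (val s * val t) (rpredM (valP s) (valP t)).

Definition loc_frac (a : A) (s : {s : A | s \in S}) : localization :=
  \pi_localization (a, s).

Definition to_loc (a : A) : localization := loc_frac a denom1.

Definition addr_ x y : ratios :=
  (x.1 * val y.2 + y.1 * val x.2, denomM x.2 y.2).
Definition oppr_ x : ratios := (- x.1, x.2).
Definition mulr_ x y : ratios := (x.1 * y.1, denomM x.2 y.2).

Definition loc_add := lift_op2 localization addr_.
Definition loc_opp := lift_op1 localization oppr_.
Definition loc_mul := lift_op2 localization mulr_.

Lemma loc_reprP x : exists2 u, u \in S &
  u * (x.1 * val (repr (\pi_localization x)).2)
  = u * ((repr (\pi_localization x)).1 * val x.2).
Proof. by apply/loc_eqP; rewrite reprK. Qed.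

Lemma pi_loc_add : {morph \pi : x y / addr_ x y >-> loc_add x y}.
Proof.
move=> x y; unlock loc_add; apply/eqP/loc_eqP => /=.
have [u Su] := loc_reprP x; have [v Sv] := loc_reprP y.
move: (repr _) (repr _) => [c [/= r Sr]] [d [/= q Sq]].
case: x y => [a [/= s Ss]] [b [/= t St]] /= yE xE.
exists (u * v); rewrite ?rpredM //.
have -> : u * v * ((a * t + b * s) * (r * q))
          = u * (a * r) * (v * t * q) + v * (b * q) * (u * s * r) by ring.
by rewrite xE yE; ring.
Qed.
Canonical pi_loc_add_morph := PiMorph2 pi_loc_add.

Lemma pi_loc_opp : {morph \pi : x / oppr_ x >-> loc_opp x}.
Proof.
move=> x; unlock loc_opp; apply/eqP/loc_eqP => /=.
have [u Su xE] := loc_reprP x; exists u => //.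
by rewrite !mulNr !mulrN xE.
Qed.
Canonical pi_loc_opp_morph := PiMorph1 pi_loc_opp.

Lemma pi_loc_mul : {morph \pi : x y / mulr_ x y >-> loc_mul x y}.
Proof.
move=> x y; unlock loc_mul; apply/eqP/loc_eqP => /=.
have [u Su] := loc_reprP x; have [v Sv] := loc_reprP y.
move: (repr _) (repr _) => [c [/= r Sr]] [d [/= q Sq]].
case: x y => [a [/= s Ss]] [b [/= t St]] /= yE xE.
exists (u * v); rewrite ?rpredM //.
have -> : u * v * (a * b * (r * q)) = u * (a * r) * (v * (b * q)) by ring.
by rewrite xE yE; ring.
Qed.
Canonical pi_loc_mul_morph := PiMorph2 pi_loc_mul.

Fact loc_eq x y : x.1 * val y.2 = y.1 * val x.2 ->
  \pi_localization x = \pi_localization y.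
Proof. by move=> xy; apply/eqP/loc_eqP; exists 1; rewrite ?rpred1 ?xy. Qed.

Fact loc_addA : associative loc_add.
Proof.
elim/quotW=> x; elim/quotW=> y; elim/quotW=> z; rewrite !piE.
by apply: loc_eq => /=; ring.
Qed.

Fact loc_addC : commutative loc_add.
Proof.
by elim/quotW=> x; elim/quotW=> y; rewrite !piE; apply: loc_eq => /=; ring.
Qed.

Fact loc_add0 : left_id (to_loc 0) loc_add.
Proof.
by elim/quotW=> x; rewrite /to_loc /loc_frac !piE; apply: loc_eq => /=; ring.
Qed.

Fact loc_addN : left_inverse (to_loc 0) loc_opp loc_add.
Proof.
by elim/quotW=> x; rewrite /to_loc /loc_frac !piE; apply: loc_eq => /=; ring.
Qed.

HB.instance Definition _ := GRing.isZmodule.Build localization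
  loc_addA loc_addC loc_add0 loc_addN.

Fact loc_mulA : associative loc_mul.
Proof.
elim/quotW=> x; elim/quotW=> y; elim/quotW=> z; rewrite !piE.
by apply: loc_eq => /=; ring.
Qed.

Fact loc_mulC : commutative loc_mul.
Proof.
by elim/quotW=> x; elim/quotW=> y; rewrite !piE; apply: loc_eq => /=; ring.
Qed.

Fact loc_mul1 : left_id (to_loc 1) loc_mul.
Proof.
by elim/quotW=> x; rewrite /to_loc /loc_frac !piE; apply: loc_eq => /=; ring.
Qed.

Fact loc_mulr1 : right_id (to_loc 1) loc_mul.
Proof. by move=> x; rewrite loc_mulC loc_mul1. Qed.

Fact loc_mulDl : left_distributive loc_mul +%R.
Proof.
elim/quotW=> x; elim/quotW=> y; elim/quotW=> z.
by rewrite /GRing.add /= !piE; apply: loc_eq => /=; ring.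
Qed.

Fact loc_mulDr : right_distributive loc_mul +%R.
Proof. by move=> x y z; rewrite loc_mulC loc_mulDl !(loc_mulC x). Qed.

HB.instance Definition _ := GRing.Zmodule_isPzRing.Build localization
  loc_mulA loc_mul1 loc_mulr1 loc_mulDl loc_mulDr.
HB.instance Definition _ :=
  GRing.PzRing_hasCommutativeMul.Build localization loc_mulC.

Lemma loc_fracD a b s t :
  loc_frac a s + loc_frac b t = loc_frac (a * val t + b * val s) (denomM s t).
Proof. by rewrite /GRing.add /= /loc_frac !piE. Qed.

Lemma loc_fracM a b s t :
  loc_frac a s * loc_frac b t = loc_frac (a * b) (denomM s t).
Proof. by rewrite /GRing.mul /= /loc_frac !piE. Qed.

Lemma loc_fracP a b s t :
  loc_frac a s = loc_frac b t <->
  exists2 u, u \in S & u * (a * val t) = u * (b * val s).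
Proof. by split=> [/eqP/loc_eqP // | st]; apply/eqP/loc_eqP. Qed.

Lemma loc_ind (P : localization -> Prop) :
  (forall a s, P (loc_frac a s)) -> forall f, P f.
Proof. by move=> Pf; elim/quotW=> -[a s]; apply: Pf. Qed.

Fact to_loc_zmod_morphism : zmod_morphism to_loc.
Proof.
move=> a b; apply: (addIr (to_loc b)); rewrite subrK loc_fracD.
by apply: loc_eq => /=; ring.
Qed.

Fact to_loc_monoid_morphism : monoid_morphism to_loc.
Proof. by split=> // a b; rewrite loc_fracM; apply: loc_eq => /=; ring. Qed.

HB.instance Definition _ :=
  GRing.isZmodMorphism.Build A localization to_loc to_loc_zmod_morphism.
HB.instance Definition _ :=
  GRing.isMonoidMorphism.Build A localization to_loc to_loc_monoid_morphism.

End Localization.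

Section Laurent.
Variables (R : comPzRingType) (I : choiceType).

Definition polynomials : Type := monoid_algebra R (dirsum I nat).

HB.instance Definition _ := GRing.ComPzRing.on polynomials.
HB.instance Definition _ := GRing.Lmodule.on polynomials.

Definition poly_var (k : I) : polynomials := eps R (dirsum_in k 1%N).

Definition monomial (n : dirsum I nat) : polynomials :=
  \prod_(k <- dsupp n) poly_var k ^+ dirsum_fun n k.

Definition monomials : {pred polynomials} :=
  fun p => `[< exists n, p = monomial n >].

Lemma dirsum_natE (n : dirsum I nat) :
  n = \sum_(k <- dsupp n) dirsum_in k 1%N *+ dirsum_fun n k.
Proof.
apply: dirsumP => j.
have funD (u v : dirsum I nat) : dirsum_fun (u + v) j = dirsum_fun u j + dirsum_fun v j.
  exact: dirsum_addE.
have fun0 : dirsum_fun (0 : dirsum I nat) j = 0 by exact: dirsum0E.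
have funMn (u : dirsum I nat) m : dirsum_fun (u *+ m) j = dirsum_fun u j *+ m.
  by elim: m => [|m IHm]; rewrite ?mulr0n // !mulrS funD IHm.
rewrite (big_morph (fun u => dirsum_fun u j) funD fun0).
under eq_bigr do rewrite funMn dirsum_inE.
case: (boolP (j \in dsupp n)) => [jn|jn].
  rewrite (big_fsetD1 j) //= eqxx big_seq big1 => [|k].
    by rewrite addr0 natn.
  by rewrite in_fsetD1 eq_sym => /andP[/negPf -> _]; rewrite mul0rn.
rewrite (dsuppPn jn) big_seq big1 // => k kn.
by case: eqP => [jk|_]; rewrite ?mul0rn // jk kn in jn *.
Qed.

Lemma monomialE n : monomial n = eps R n.
Proof.
rewrite [in RHS](dirsum_natE n) eps_sum; apply: eq_bigr => k _.
by rewrite epsMn.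
Qed.

Fact monomials_mulr_closed : mulr_closed monomials.
Proof.
split=> [|p q /asboolP[m ->] /asboolP[n ->]]; apply/asboolP.
  by exists 0; rewrite monomialE eps0.
by exists (m + n); rewrite !monomialE epsD.
Qed.

HB.instance Definition _ :=
  GRing.isMulClosed.Build polynomials monomials monomials_mulr_closed.

Definition laurent : Type := localization monomials.

HB.instance Definition _ := GRing.ComPzRing.on laurent.

Definition laurent_of_poly : polynomials -> laurent := @to_loc _ monomials.

HB.instance Definition _ := GRing.RMorphism.on laurent_of_poly.

Definition laurent_scale (c : R) (z : laurent) : laurent :=
  laurent_of_poly (c *: (1 : polynomials)) * z.

Fact laurent_scaleA c d z :
  laurent_scale c (laurent_scale d z) = laurent_scale (c * d) z.
Proof.
rewrite /laurent_scale mulrA -rmorphM.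
by rewrite -scale_mull mul1r scalerA.
Qed.

Fact laurent_scale1 : left_id 1 laurent_scale.
Proof. by move=> z; rewrite /laurent_scale scale1r rmorph1 mul1r. Qed.

Fact laurent_scaleDr : right_distributive laurent_scale +%R.
Proof. by move=> c y z; rewrite /laurent_scale mulrDr. Qed.

Fact laurent_scaleDl z : {morph laurent_scale^~ z : c d / c + d}.
Proof. by move=> c d; rewrite /laurent_scale scalerDl rmorphD mulrDl. Qed.

HB.instance Definition _ := GRing.Zmodule_isLmodule.Build R laurent
  laurent_scaleA laurent_scale1 laurent_scaleDr laurent_scaleDl.

Lemma laurent_of_polyZ c p : laurent_of_poly (c *: p) = c *: laurent_of_poly p.
Proof. by rewrite -[in LHS](mul1r p) scale_mull rmorphM. Qed.

Definition laurent_var (k : I) : laurent := laurent_of_poly (poly_var k).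

(* f is an R-algebra homomorphism R[x_k^(+-1) : k in I] -> R[dirsum I Z]
   sending every x_k to eps e_k. *)
Definition is_canonical_map
    (f : {rmorphism laurent -> monoid_algebra R (dirsum I int)}) : Prop :=
  scalable f /\ forall k, f (laurent_var k) = eps R (dirsum_in k 1%Z).

End Laurent.

(* Main.v *)
(* The monoid inclusion N^(I) -> Z^(I) induces an injective R-algebra morphism
   from polynomials to the group ring. It sends each monomial eps n to a unit,
   with inverse eps (- n), so it extends to the localization. The extension is
   injective because the morphism on polynomials is, and surjective because each
   z in Z^(I) is a difference m - n, so that eps z is the image of x^m / x^n. *)
Require Import Defs.
From HB Require Import structures.
From mathcomp Require Import all_boot all_order all_algebra.
From mathcomp Require Import finmap boolp ring.
From mathcomp.multinomials Require Import monalg.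

Set Implicit Arguments.
Unset Strict Implicit.
Unset Printing Implicit Defensive.

Import Order.TTheory GRing.Theory Num.Theory.
Local Open Scope fset_scope.
Local Open Scope ring_scope.

(** Since [bijective] asks for an actual inverse function, [choice] assembles one from the
    preimages. *)
Lemma inj_surj_bij (T U : Type) (f : T -> U) :
  injective f -> (forall y, exists x, f x = y) -> bijective f.
Proof.
move=> f_inj f_surj; have [g gP] := choice f_surj.
by exists g => // x; apply: f_inj; rewrite gP.
Qed.

Lemma scaleU (R : comPzRingType) (A : nmodType) (c d : R) (a : A) :
  c *: (<< d *g a >> : monoid_algebra R A) = << c * d *g a >>.
Proof. by apply/malgP => x; rewrite [LHS]scaleE !mcoeffU mulrnAr. Qed.

(** * Functoriality of the monoid algebra in the monoid *)

Section MonoidAlgebraMap.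
Variables (R : comPzRingType) (A B : nmodType) (h : {additive A -> B}).
Implicit Types g : monoid_algebra R A.

Definition monoid_algebra_map g : monoid_algebra R B :=
  \sum_(a <- msupp g) << g@_a *g h a >>.

(** Extra indices contribute zero terms. Elements with different supports can thus be summed over
    one common index set, which gives additivity. *)
Lemma monoid_algebra_mapw (d : {fset A}) g : msupp g `<=` d ->
  monoid_algebra_map g = \sum_(a <- d) << g@_a *g h a >>.
Proof.
move=> le; apply: big_fset_incl => // a _ /mcoeff_outdom ->.
by rewrite monalgU0.
Qed.

Fact monoid_algebra_map_nmod_morphism : nmod_morphism monoid_algebra_map.
Proof.
split=> [|g1 g2]; first by rewrite /monoid_algebra_map msupp0 big_seq_fset0.
rewrite (monoid_algebra_mapw (msuppD_le g1 g2)).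
rewrite (monoid_algebra_mapw (fsubsetUl _ (msupp g2))).
rewrite (monoid_algebra_mapw (fsubsetUr (msupp g1) _)) -big_split.
by apply: eq_bigr => a _; rewrite mcoeffD monalgUD.
Qed.

HB.instance Definition _ := GRing.isNmodMorphism.Build
  (monoid_algebra R A) (monoid_algebra R B) monoid_algebra_map
  monoid_algebra_map_nmod_morphism.

Lemma monoid_algebra_mapU (c : R) a :
  monoid_algebra_map << c *g a >> = << c *g h a >>.
Proof. by rewrite (monoid_algebra_mapw msuppU_le) big_seq_fset1 mcoeffUU. Qed.

Lemma monoid_algebra_map_eps a : monoid_algebra_map (eps R a) = eps R (h a).
Proof. exact: monoid_algebra_mapU. Qed.

Fact monoid_algebra_map_monoid_morphism : monoid_morphism monoid_algebra_map.
Proof.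
split=> [|g1 g2]; first by rewrite -eps0 monoid_algebra_map_eps raddf0.
rewrite [g1 * g2](mulw (fsubset_refl _) (fsubset_refl _)) raddf_sum mulr_suml.
apply: eq_bigr => a _; rewrite raddf_sum mulr_sumr; apply: eq_bigr => b _ /=.
by rewrite monoid_algebra_mapU raddfD [RHS]mulUU.
Qed.

HB.instance Definition _ := GRing.isMonoidMorphism.Build
  (monoid_algebra R A) (monoid_algebra R B) monoid_algebra_map
  monoid_algebra_map_monoid_morphism.

Lemma monoid_algebra_mapZ : scalable monoid_algebra_map.
Proof.
move=> c g; rewrite [in LHS](monoid_algebraE g) !raddf_sum.
by apply: eq_bigr => a _; rewrite /= !scaleU mulr1 monoid_algebra_mapU.
Qed.

(** As [h] merges no two basis elements, only the term at [a] contributes to the coefficient at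
    [h a]. *)
Lemma mcoeff_monoid_algebra_map g a :
  injective h -> (monoid_algebra_map g)@_(h a) = g@_a.
Proof.
move=> h_inj; rewrite [in RHS](monalgE g) !raddf_sum.
by apply: eq_bigr => b _ /=; rewrite !mcoeffU (inj_eq h_inj).
Qed.

Lemma monoid_algebra_map_inj : injective h -> injective monoid_algebra_map.
Proof.
move=> h_inj g1 g2 g12; apply/malgP => a.
by rewrite -!(mcoeff_monoid_algebra_map _ _ h_inj) g12.
Qed.

End MonoidAlgebraMap.

(** * The universal property of localization *)

Section LocalizationLift.
Variables (A B : comPzRingType) (S : mulrClosed A).
Implicit Types f g : {rmorphism localization S -> B}.

Lemma loc_fracK a (s : {s : A | s \in S}) :
  loc_frac a s * to_loc S (val s) = to_loc S a.
Proof. by rewrite loc_fracM; apply: loc_eq => /=; ring. Qed.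

Lemma loc_frac_to_loc a (s : {s : A | s \in S}) :
  loc_frac a s = to_loc S a * loc_frac 1 s.
Proof. by rewrite loc_fracM; apply: loc_eq => /=; ring. Qed.

(** A fraction is [a] times the inverse of [s], and a ring morphism has no freedom on inverses: the
    images of [1/s] are inverse to the common image of [s]. *)
Lemma loc_rmorph_eq f g :
  (forall a, f (to_loc S a) = g (to_loc S a)) -> f =1 g.
Proof.
move=> fg; elim/loc_ind => a s; rewrite loc_frac_to_loc !rmorphM fg.
congr (_ * _).
have inv1 : to_loc S (val s) * loc_frac 1 s = 1.
  by rewrite mulrC loc_fracK rmorph1.
rewrite -[LHS]mulr1 -(rmorph1 g) -inv1 rmorphM mulrA -fg -rmorphM mulrC.
by rewrite [X in f X]mulrC inv1 rmorph1 mulr1.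
Qed.

(** Clearing denominators in [f (a/s) = f (b/t)] gives equal images of [a t] and [b s]. These then
    agree in [A] itself, so [1] serves as the witness for equality of fractions. *)
Lemma loc_rmorph_inj f :
  injective (fun a => f (to_loc S a)) -> injective f.
Proof.
move=> f_inj; elim/loc_ind => a s; elim/loc_ind => b t fst.
apply/loc_fracP; exists 1; first exact: rpred1.
congr (_ * _); apply: f_inj; rewrite !rmorphM /=.
by rewrite -(loc_fracK a s) -(loc_fracK b t) !rmorphM fst mulrAC.
Qed.

Variable phi : {rmorphism A -> B}.
Hypothesis phi_unit : forall s, s \in S -> exists t, phi s * t = 1.

Lemma loc_lift :
  exists f : {rmorphism localization S -> B}, forall a, f (to_loc S a) = phi a.
Proof.
have [inv invP] := choice (fun s : {s | s \in S} => phi_unit (valP s)).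
(* [F] is computed on a chosen representative; [FE] shows that any other fraction gives the same
   value. *)
pose F (x : localization S) := phi (repr x).1 * inv (repr x).2.
have FE a s : F (loc_frac a s) = phi a * inv s.
  have [u Su] := loc_reprP (a, s); rewrite /F /loc_frac.
  case: (repr _) => b t /= /(congr1 phi); rewrite !rmorphM => uab.
  have [v uv] := phi_unit Su.
  (* The factor [u] from the equality of fractions cancels because [phi u] is invertible. *)
  have ab : phi a * phi (val t) = phi b * phi (val s).
    by rewrite -[LHS]mul1r -[RHS]mul1r -uv ![_ * v]mulrC -!mulrA uab.
  rewrite -[LHS]mulr1 -(invP s) -[RHS]mulr1 -(invP t).
  have -> : phi b * inv t * (phi (val s) * inv s) =
            phi b * phi (val s) * (inv t * inv s) by ring.
  by rewrite -ab; ring.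
have F_to a : F (to_loc S a) = phi a.
  rewrite FE; have := invP (denom1 S); rewrite /= rmorph1 mul1r => ->.
  by rewrite mulr1.
have F_frac a s : F (loc_frac a s) * phi (val s) = phi a.
  by rewrite FE -mulrA [inv s * _]mulrC invP mulr1.
(* Images of denominators are cancellable, so both morphism laws may be checked after multiplying by
   the image of a common denominator. *)
have F_eq x y s : s \in S -> x * phi s = y * phi s -> x = y.
  move=> /phi_unit[t st] xy.
  by rewrite -[x]mulr1 -[y]mulr1 -st !mulrA xy.
have F_add : nmod_morphism F.
  split; first by rewrite -(rmorph0 (to_loc S)) F_to rmorph0.
  elim/loc_ind => a s; elim/loc_ind => b t.
  apply: (F_eq _ _ _ (valP (denomM s t))); rewrite loc_fracD F_frac.
  rewrite rmorphD !rmorphM -(F_frac a s) -(F_frac b t) /=.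
  by ring.
have F_mul : monoid_morphism F.
  split; first by rewrite -(rmorph1 (to_loc S)) F_to rmorph1.
  elim/loc_ind => a s; elim/loc_ind => b t.
  apply: (F_eq _ _ _ (valP (denomM s t))); rewrite loc_fracM F_frac.
  rewrite !rmorphM -(F_frac a s) -(F_frac b t) /=.
  by ring.
pose FA := GRing.isNmodMorphism.Build _ _ F F_add.
pose FM := GRing.isMonoidMorphism.Build _ _ F F_mul.
pose f : {rmorphism localization S -> B} := HB.pack F FA FM.
by exists f.
Qed.

End LocalizationLift.

(** * Natural exponents inside integer exponents *)

Section Exponents.
Variable I : choiceType.
Implicit Types n : dirsum I nat.

Definition dirsum_posz n : dirsum I int :=
  [fsfun k in dsupp n => Posz (dirsum_fun n k)].

Lemma dirsum_poszE n k : dirsum_fun (dirsum_posz n) k = Posz (dirsum_fun n k).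
Proof. by rewrite [LHS]fsfunE; case: ifPn => // /dsuppPn ->. Qed.

Fact dirsum_posz_nmod_morphism : nmod_morphism dirsum_posz.
Proof.
split=> [|m n]; apply: dirsumP => k; first by rewrite dirsum_poszE !dirsum0E.
by rewrite dirsum_addE !dirsum_poszE dirsum_addE PoszD.
Qed.

HB.instance Definition _ := GRing.isNmodMorphism.Build
  (dirsum I nat) (dirsum I int) dirsum_posz dirsum_posz_nmod_morphism.

Lemma dirsum_posz_inj : injective dirsum_posz.
Proof.
move=> m n mn; apply: dirsumP => k; apply: (can_inj absz_nat).
by rewrite -!dirsum_poszE mn.
Qed.

Lemma dirsum_posz_in k (a : nat) :
  dirsum_posz (dirsum_in k a) = dirsum_in k (Posz a).
Proof.
by apply: dirsumP => j; rewrite dirsum_poszE !dirsum_inE; case: ifP.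
Qed.

Lemma dirsum_int_sub (z : dirsum I int) :
  exists m n, z = dirsum_posz m - dirsum_posz n.
Proof.
pose part (p : int -> nat) : dirsum I nat :=
  [fsfun k in dsupp z => p (dirsum_fun z k)].
(* Off the support of [z], [part p] defaults to 0, hence the condition on [p 0]. *)
have partE p k : p 0 = 0%N -> dirsum_fun (part p) k = p (dirsum_fun z k).
  by move=> p0; rewrite [LHS]fsfunE; case: ifPn => // /dsuppPn ->.
(* The witnesses are the positive and negative parts of [z]. *)
exists (part (fun i => if 0 <= i then `|i|%N else 0%N)).
exists (part (fun i => if 0 <= i then 0%N else `|i|%N)).
apply: dirsumP => k; rewrite [RHS]dirsum_addE [X in _ + X]dirsum_oppE.
rewrite !dirsum_poszE !partE //.
case: (lerP 0 (dirsum_fun z k)) => zk; first by rewrite subr0 gez0_abs.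
by rewrite sub0r ltz0_abs // opprK.
Qed.

End Exponents.

(** * The canonical map: uniqueness, existence, bijectivity *)

Section Laurent.
Variables (R : comPzRingType) (I : choiceType).

Local Notation group_ring := (monoid_algebra R (dirsum I int)).

(** Agreement on polynomials suffices; linearity reduces this to monomials, and multiplicativity to
    the variables. *)
Lemma canonical_map_uniq (f g : {rmorphism laurent R I -> group_ring}) :
  is_canonical_map f -> is_canonical_map g -> f =1 g.
Proof.
move=> [fZ fX] [gZ gX]; apply: loc_rmorph_eq => p.
rewrite -/(laurent_of_poly p) (monoid_algebraE p).
rewrite (rmorph_sum (@laurent_of_poly R I)) !rmorph_sum.
apply: eq_bigr => n _; rewrite /= (laurent_of_polyZ p@_n (eps R n)) fZ gZ.
congr (_ *: _); rewrite -monomialE /monomial.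
rewrite (rmorph_prod (@laurent_of_poly R I)) !rmorph_prod.
apply: eq_bigr => k _.
by rewrite !rmorphXn; congr (_ ^+ _); rewrite [LHS]fX [RHS]gX.
Qed.

Local Notation poly_map := (monoid_algebra_map (R := R) (@dirsum_posz I)).

(** Extending [poly_map] on all polynomials, not just prescribing the images of the variables, is
    what later gives injectivity. *)
Lemma canonical_map_exists :
  exists f : {rmorphism laurent R I -> group_ring},
    forall p, f (laurent_of_poly p) = poly_map p.
Proof.
apply: loc_lift => _ /asboolP[n ->].
exists (eps R (- dirsum_posz n)).
by rewrite monomialE /= monoid_algebra_map_eps -epsD subrr eps0.
Qed.

Variable f : {rmorphism laurent R I -> group_ring}.
Hypothesis f_poly : forall p, f (laurent_of_poly p) = poly_map p.

Lemma lift_eps n : f (laurent_of_poly (eps R n)) = eps R (dirsum_posz n).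
Proof. by rewrite f_poly monoid_algebra_map_eps. Qed.

Lemma lift_canonical : is_canonical_map f.
Proof.
have fZ : scalable f.
  (* Scaling by [c] on Laurent polynomials is multiplication by the constant polynomial [c], so
     linearity follows from multiplicativity. *)
  move=> c z; rewrite -[c *: z]/(laurent_scale c z) rmorphM f_poly.
  by rewrite monoid_algebra_mapZ rmorph1 -scale_mull mul1r.
split=> // k.
by rewrite [LHS]lift_eps dirsum_posz_in.
Qed.

Lemma lift_bij : bijective f.
Proof.
have [fZ _] := lift_canonical.
apply: inj_surj_bij => [|g].
  apply: loc_rmorph_inj => p q; rewrite -!/(laurent_of_poly _) !f_poly.
  exact/monoid_algebra_map_inj/dirsum_posz_inj.
(* The image is closed under sums, so it is enough to reach each scaled basis element. *)
rewrite (monoid_algebraE g); elim/big_ind: _ => [|_ _ [x <-] [y <-]|z _].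
- by exists 0; rewrite rmorph0.
- by exists (x + y); rewrite rmorphD.
have [m [n ->]] := dirsum_int_sub z.
have Sn : eps R n \in @monomials R I.
  by apply/asboolP; exists n; rewrite monomialE.
pose x : laurent R I :=
  @loc_frac (polynomials R I) _ (eps R m) (exist _ (eps R n) Sn).
(* Multiplying [x] by its denominator leaves its numerator; the unit [eps R (dirsum_posz n)] is then
   cancelled. *)
have fx : f x * eps R (dirsum_posz n) = eps R (dirsum_posz m).
  by rewrite -!lift_eps -rmorphM; congr (f _); apply: loc_fracK.
exists (g@_(dirsum_posz m - dirsum_posz n) *: x); rewrite fZ; congr (_ *: _).
by rewrite epsD -fx -mulrA -epsD subrr eps0 mulr1.
Qed.

End Laurent.

Theorem corollary2p12 (R : comPzRingType) (I : choiceType) :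
  exists f : {rmorphism laurent R I -> monoid_algebra R (dirsum I int)},
    [/\ is_canonical_map f,
        (forall g : {rmorphism laurent R I -> monoid_algebra R (dirsum I int)},
           is_canonical_map g -> g =1 f)
      & bijective f].
Proof.
have [f f_poly] := canonical_map_exists R I.
have f_can := lift_canonical f_poly.
exists f; split=> // [g g_can|]; last exact: lift_bij f_poly.
exact: canonical_map_uniq.
Qed.
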